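(* Let $f_1=|+\rangle\langle +|$ with $|+\rangle=(|0\rangle+|1\rangle)/\sqrt2\in\mathbb{C}^2$. A linear map $\Lambda$ on $M_2(\mathbb{C})$ is completely positive, trace preserving and satisfies $\Lambda(f_1)=f_1$ if and only if there exist real numbers $\eta$, $\ell\ge 0$, $\theta$ and a vector $\mathbf{q}\in\mathbb{R}^2$ satisfying $$0\le\eta\le1,\qquad 0\le \ell\le\sqrt{\eta},\qquad \|\mathbf{q}\|^2\le(1-\eta)\left(\eta-\ell^2\right),$$ such that for every qubit density matrix $\varrho$ with Bloch vector $(x,y,z)$, the Bloch vector $(x',y',z')$ of $\Lambda(\varrho)$ is given by $$x'=1-\eta+\eta x,\qquad \begin{pmatrix} y' \\ z' \end{pmatrix}=\ell\begin{pmatrix} \cos\theta & -\sin\theta \\ \sin\theta & \cos\theta \end{pmatrix}\begin{pmatrix} y \\ z \end{pmatrix}+(1-x)\,\mathbf{q}.$$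
   Context: $\{|0\rangle,|1\rangle\}$ is the standard basis of $\mathbb{C}^2$. The Bloch vector of a $2\times2$ density matrix $\varrho$ is the $(x,y,z)\in\mathbb{R}^3$ with $\varrho=\frac12(\mathbb{1}+x\sigma_x+y\sigma_y+z\sigma_z)$, where $\sigma_x,\sigma_y,\sigma_z$ are the Pauli matrices. $\|\cdot\|$ is the Euclidean norm. (The maps described are the free operations of quantum-state texture for a single qubit.) *)

(* Defs.v *)
From HB Require Import structures.
From mathcomp Require Import all_boot all_order all_algebra.
From mathcomp Require Import complex mxtens.
From mathcomp Require Import reals trigo.

Set Implicit Arguments.
Unset Strict Implicit.
Unset Printing Implicit Defensive.

Import Order.TTheory GRing.Theory Num.Theory.

Local Open Scope ring_scope.
Local Open Scope complex_scope.
Local Open Scope sesquilinear_scope.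

Section Channels.
Variable C : numClosedFieldType.

(* In a numClosedFieldType, 0 <= z means that z is real and nonnegative. *)
Definition psdmx n (A : 'M[C]_n) : Prop :=
  A ^t* = A /\ forall v : 'cV[C]_n, 0 <= (v ^t* *m A *m v) 0 0.

Definition density n (rho : 'M[C]_n) : Prop := psdmx rho /\ \tr rho = 1.

(* The (i, j) block of X in M_n(C) (x) M_d(C) = M_n(M_d(C)). *)
Definition tens_block n d (X : 'M[C]_(n * d)) (i j : 'I_n) : 'M[C]_d :=
  \matrix_(k, l) X (mxtens_index (i, k)) (mxtens_index (j, l)).

(* id_n (x) L applied to X, where X = \sum_i \sum_j delta_mx i j *t tens_block X i j. *)
Definition ampliation d (L : 'M[C]_d -> 'M[C]_d) n (X : 'M[C]_(n * d)) :
  'M[C]_(n * d) :=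
  \sum_(i < n) \sum_(j < n) (delta_mx i j *t L (tens_block X i j)).

Definition completely_positive d (L : 'M[C]_d -> 'M[C]_d) : Prop :=
  forall n (X : 'M[C]_(n * d)), psdmx X -> psdmx (ampliation L X).

Definition trace_preserving d (L : 'M[C]_d -> 'M[C]_d) : Prop :=
  forall A : 'M[C]_d, \tr (L A) = \tr A.

End Channels.

Section Qubit.
Variable R : realType.

Definition ket0 : 'cV[R[i]]_2 := delta_mx 0 0.
Definition ket1 : 'cV[R[i]]_2 := delta_mx 1 0.
Definition ket_plus : 'cV[R[i]]_2 :=
  ((Num.sqrt (2 : R))^-1)%:C *: (ket0 + ket1).
Definition f1 : 'M[R[i]]_2 := ket_plus *m ket_plus ^t*.

Definition sigma_x : 'M[R[i]]_2 := delta_mx 0 1 + delta_mx 1 0.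
Definition sigma_y : 'M[R[i]]_2 := (0 +i* 1) *: (delta_mx 1 0 - delta_mx 0 1).
Definition sigma_z : 'M[R[i]]_2 := delta_mx 0 0 - delta_mx 1 1.

Definition has_bloch (rho : 'M[R[i]]_2) (x y z : R) : Prop :=
  rho = 2^-1 *: (1%:M + x%:C *: sigma_x + y%:C *: sigma_y + z%:C *: sigma_z).

Definition vec2 (a b : R) : 'cV[R]_2 := \col_i (if i == 0 then a else b).

Definition rot_mx (theta : R) : 'M[R]_2 :=
  row_mx (vec2 (cos theta) (sin theta)) (vec2 (- sin theta) (cos theta)).

(* The Euclidean norm: `|q| for q : 'cV[R]_n is the sup norm in MathComp-Analysis. *)
Definition enorm n (q : 'cV[R]_n) : R := Num.sqrt (\sum_i q i 0 ^+ 2).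

End Qubit.

(* Main.v *)
From HB Require Import structures.
Require Import Defs.
From mathcomp Require Import all_boot all_order all_algebra.
From mathcomp Require Import complex mxtens ring lra.
From mathcomp Require Import reals trigo.

(** In the basis |+>, |->, which the Hadamard matrix exchanges with |0>, |1>,
    the Choi matrix of [Lambda] is positive, and it has entry 1 at (++, ++) and 0
    at (+-, +-) because |+><+| is fixed. Positivity kills the row and column of
    the zero diagonal entry, trace preservation kills one more coherence, and
    what remains is the 3 x 3 matrix
        1    0      c
        0   1-eta   w
        c^*  w^*   eta
    whose positivity means |c|^2 <= eta and
    |w|^2 <= (1 - eta) (eta - |c|^2). Conversely, a Cholesky factorization of this
    matrix yields three Kraus operators. In this basis the coherence of a
    density matrix is (z + i y) / 2, so c = l e^(-i theta) is the rotation and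
    w = q_z + i q_y the translation. *)

Import Order.TTheory GRing.Theory Num.Theory.

Set Implicit Arguments.
Unset Strict Implicit.
Unset Printing Implicit Defensive.

Local Open Scope ring_scope.
Local Open Scope sesquilinear_scope.

(** * Two by two matrices given by their four entries *)

Section TwoByTwo.
Variable T : Type.

(** A normal form for explicit matrices: once both sides are of this form, [congr mx2] turns a
    matrix identity into four scalar ones. *)
Definition mx2 (a b c d : T) : 'M[T]_2 :=
  \matrix_(i, j) if i == 0 then (if j == 0 then a else b)
                 else (if j == 0 then c else d).

Lemma mx2_eta (A : 'M[T]_2) : A = mx2 (A 0 0) (A 0 1) (A 1 0) (A 1 1).
Proof.
apply/matrixP => -[[|[|//]] i1] [[|[|//]] j1]; rewrite mxE /=;
  by congr (A _ _); apply: val_inj.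
Qed.

End TwoByTwo.

Lemma map_mx2 (S T : Type) (f : S -> T) (a b c d : S) :
  map_mx f (mx2 a b c d) = mx2 (f a) (f b) (f c) (f d).
Proof. by rewrite [LHS]mx2_eta !mxE. Qed.

Lemma tr_mx2 (T : Type) (a b c d : T) : (mx2 a b c d)^T = mx2 a c b d.
Proof. by rewrite [LHS]mx2_eta !mxE. Qed.

Section TwoByTwoRing.
Variable F : pzRingType.
Implicit Types k a b c d : F.

Lemma mx2D a b c d (a' b' c' d' : F) :
  mx2 a b c d + mx2 a' b' c' d' = mx2 (a + a') (b + b') (c + c') (d + d').
Proof. by rewrite [LHS]mx2_eta !mxE. Qed.

Lemma mx2Z k a b c d :
  k *: mx2 a b c d = mx2 (k * a) (k * b) (k * c) (k * d).
Proof. by rewrite [LHS]mx2_eta !mxE. Qed.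

Lemma mx2M a b c d (a' b' c' d' : F) :
  mx2 a b c d *m mx2 a' b' c' d' =
  mx2 (a * a' + b * c') (a * b' + b * d') (c * a' + d * c') (c * b' + d * d').
Proof.
by rewrite [LHS]mx2_eta !mxE !big_ord_recl !big_ord0 !mxE /= !addr0.
Qed.

Lemma mx2_1 : 1%:M = mx2 1 0 0 1 :> 'M[F]_2.
Proof. by rewrite [LHS]mx2_eta !mxE. Qed.

Lemma mx2_delta (i j : 'I_2) :
  delta_mx i j = mx2 ((i == 0) && (j == 0))%:R ((i == 0) && (j == 1))%:R
                     ((i == 1) && (j == 0))%:R ((i == 1) && (j == 1))%:R :> 'M[F]_2.
Proof. by rewrite [LHS]mx2_eta !mxE; congr mx2; rewrite eq_sym [_ == j]eq_sym. Qed.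

Lemma mxtrace_mx2 a b c d : \tr (mx2 a b c d) = a + d.
Proof. by rewrite /mxtrace !big_ord_recl big_ord0 !mxE /= addr0. Qed.
End TwoByTwoRing.

(** * Positive semidefinite matrices and operations on completely positive maps *)

Section CompletePositivity.
Variable C : numClosedFieldType.

Lemma adjmxM m n p (A : 'M[C]_(m, n)) (B : 'M[C]_(n, p)) :
  (A *m B) ^t* = B ^t* *m A ^t*.
Proof. by rewrite trmx_mul map_mxM. Qed.

Lemma adjmxD m n (A B : 'M[C]_(m, n)) : (A + B) ^t* = A ^t* + B ^t*.
Proof. by rewrite linearD map_mxD. Qed.

Lemma adjmxZ m n k (A : 'M[C]_(m, n)) : (k *: A) ^t* = k^* *: A ^t*.
Proof. by rewrite linearZ /= map_mxZ. Qed.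

Lemma psdmxD n (A B : 'M[C]_n) : psdmx A -> psdmx B -> psdmx (A + B).
Proof.
move=> [hA pA] [hB pB]; split=> [|v]; first by rewrite adjmxD hA hB.
by rewrite mulmxDr mulmxDl mxE addr_ge0.
Qed.

Lemma psdmx_congr m n (A : 'M[C]_n) (K : 'M[C]_(m, n)) :
  psdmx A -> psdmx (K *m A *m K ^t*).
Proof.
move=> [hA pA]; split=> [|v]; first by rewrite !adjmxM trmxCK hA mulmxA.
by have := pA (K ^t* *m v); rewrite adjmxM trmxCK !mulmxA.
Qed.

Lemma psdmx_outer n (v : 'cV[C]_n) : psdmx (v *m v ^t*).
Proof.
split=> [|u]; first by rewrite adjmxM trmxCK.
rewrite !mulmxA -mulmxA -[v ^t* *m u]trmxCK adjmxM trmxCK mxE big_ord1 !mxE.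
exact: mul_conjC_ge0.
Qed.

(** Only the summand (i, j) meets the block (i, j). With [eq_tens_block] this reduces every identity
    between ampliations to an identity between blocks. *)
Lemma tens_block_ampliation d (L : 'M[C]_d -> 'M[C]_d) n (X : 'M[C]_(n * d)) i j :
  tens_block (ampliation L X) i j = L (tens_block X i j).
Proof.
apply/matrixP => k l; rewrite mxE /ampliation summxE (bigD1 i) //= summxE.
rewrite (bigD1 j) //= tensmxE mxE !eqxx mul1r !big1 ?addr0 //.
  move=> i' ne; rewrite summxE big1 // => j' _.
  by rewrite tensmxE mxE eq_sym (negPf ne) mul0r.
by move=> j' ne; rewrite tensmxE mxE eqxx eq_sym (negPf ne) mul0r.
Qed.

Lemma sum_mxtens n d (F : 'I_(n * d) -> C) :
  \sum_a F a = \sum_i \sum_k F (mxtens_index (i, k)).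
Proof.
rewrite pair_bigA; apply: reindex => /=; exists (@mxtens_unindex n d) => a _.
  by rewrite -surjective_pairing mxtens_indexK.
by rewrite -surjective_pairing mxtens_unindexK.
Qed.

Lemma eq_tens_block n d (X Y : 'M[C]_(n * d)) :
  (forall i j, tens_block X i j = tens_block Y i j) -> X = Y.
Proof.
move=> e; apply/matrixP => a b.
case: (mxtens_indexP a) => i k; case: (mxtens_indexP b) => j l.
by have /matrixP/(_ k l) := e i j; rewrite !mxE.
Qed.

Lemma eq_cp d (L L' : 'M[C]_d -> 'M[C]_d) :
  L =1 L' -> completely_positive L -> completely_positive L'.
Proof.
move=> e cp n X /cp; congr psdmx; apply: eq_tens_block => i j.
by rewrite !tens_block_ampliation e.
Qed.

Lemma cp_comp d (L L' : 'M[C]_d -> 'M[C]_d) :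
  completely_positive L -> completely_positive L' -> completely_positive (L \o L').
Proof.
move=> cp cp' n X /cp' /cp; congr psdmx; apply: eq_tens_block => i j.
by rewrite !tens_block_ampliation.
Qed.

Lemma cpD d (L L' : 'M[C]_d -> 'M[C]_d) :
  completely_positive L -> completely_positive L' ->
  completely_positive (fun A => L A + L' A).
Proof.
move=> cp cp' n X pX; have := psdmxD (cp _ _ pX) (cp' _ _ pX).
congr psdmx; apply: eq_tens_block => i j; rewrite tens_block_ampliation.
by rewrite -(tens_block_ampliation L) -(tens_block_ampliation L'); apply/matrixP => k l; rewrite !mxE.
Qed.

(** The ampliation of conjugation by K is conjugation by the tensor product of the identity with K,
    and a congruence preserves positivity. *)
Lemma cp_kraus d (K : 'M[C]_d) : completely_positive (fun A => K *m A *m K ^t*).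
Proof.
move=> n X pX; have := psdmx_congr (1%:M *t K) pX.
congr psdmx; apply: eq_tens_block => i j; rewrite tens_block_ampliation.
(* The first factor of the product is the identity, so a sum over the tensor index collapses to a
   single block. *)
have sum1 (F : 'I_(n * d) -> C) i0 :
    (forall i' k, i' != i0 -> F (mxtens_index (i', k)) = 0) ->
  \sum_a F a = \sum_k F (mxtens_index (i0, k)).
  move=> F0; rewrite sum_mxtens (bigD1 i0) //=.
  by rewrite [X in _ + X]big1 ?addr0 // => i' ne; rewrite big1 // => k _; apply: F0.
apply/matrixP => k l; rewrite [LHS]mxE [LHS]mxE [RHS]mxE (sum1 _ j); last first.
  by move=> j' m ne; rewrite !mxE !mxtens_indexK /= eq_sym (negPf ne) mul0r conjC0 mulr0.
apply: eq_bigr => m _; rewrite !mxE !mxtens_indexK /= eqxx mul1r; congr (_ * _).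
rewrite (sum1 _ i); last first.
  by move=> i' m' ne; rewrite tensmxE mxE eq_sym (negPf ne) !mul0r.
by apply: eq_bigr => m' _; rewrite tensmxE !mxE eqxx mul1r.
Qed.

(** * The Choi matrix and the consequences of its positivity *)

Definition choi_mx d (L : 'M[C]_d -> 'M[C]_d) : 'M[C]_(d * d) :=
  \matrix_(a, b) L (delta_mx (mxtens_unindex a).1 (mxtens_unindex b).1)
                   (mxtens_unindex a).2 (mxtens_unindex b).2.

(** The Choi matrix is the ampliation of [L] at the rank one matrix of [w], the unnormalized
    maximally entangled vector: block (i, j) of that matrix is [delta_mx i j]. *)
Lemma choi_psd d (L : 'M[C]_d -> 'M[C]_d) :
  completely_positive L -> psdmx (choi_mx L).
Proof.
pose w : 'cV[C]_(d * d) :=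
  \col_a ((mxtens_unindex a).1 == (mxtens_unindex a).2)%:R.
move=> /(_ _ _ (psdmx_outer w)); congr psdmx.
apply: eq_tens_block => i j; rewrite tens_block_ampliation.
apply/matrixP => k l; rewrite !mxE !mxtens_indexK /=; congr (L _ _ _).
apply/matrixP => k' l'; rewrite !mxE big_ord1 !mxE !mxtens_indexK /=.
by rewrite conjC_nat -natrM mulnb eq_sym [j == _]eq_sym.
Qed.

(** The quadratic form of the Choi matrix written with a doubly indexed test vector [u], ready for
    explicit choices of [u]. *)
Lemma choi_form d (L : 'M[C]_d -> 'M[C]_d) (u : 'I_d -> 'I_d -> C) :
  completely_positive L ->
  0 <= \sum_i \sum_k \sum_j \sum_l
         (u i k)^* * L (delta_mx i j) k l * u j l.
Proof.
move=> /choi_psd[_ /(_ (\col_a u (mxtens_unindex a).1 (mxtens_unindex a).2))].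
congr (0 <= _).
rewrite -mulmxA mxE sum_mxtens; apply: eq_bigr => i _; apply: eq_bigr => k _.
rewrite !mxE sum_mxtens mulr_sumr !mxtens_indexK; apply: eq_bigr => j _.
rewrite mulr_sumr; apply: eq_bigr => l _; rewrite !mxE !mxtens_indexK /=.
by rewrite mulrA.
Qed.

Lemma choi_herm d (L : 'M[C]_d -> 'M[C]_d) i j k l :
  completely_positive L -> L (delta_mx j i) l k = (L (delta_mx i j) k l)^*.
Proof.
move=> /choi_psd[/matrixP/(_ (mxtens_index (j, l)) (mxtens_index (i, k)))].
by rewrite !mxE !mxtens_indexK.
Qed.

Lemma psdmx_diag_ge0 n (A : 'M[C]_n) i : psdmx A -> 0 <= A i i.
Proof.
move=> [_ /(_ (delta_mx i 0))]; congr (0 <= _).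
by rewrite trmx_delta map_delta_mx -rowE -colE !mxE.
Qed.

(** When the entry (i, i) vanishes, the form at -t A_ij e_i + e_j, with t real, equals A_jj - 2 t
    |A_ij|^2. If A_ij were nonzero, the chosen [t] would make this -1. *)
Lemma psdmx_diag_eq0 n (A : 'M[C]_n) i j : psdmx A -> A i i = 0 -> A i j = 0.
Proof.
move=> pA Aii; have [hA fA] := pA; apply/eqP; apply: contraT => Aij.
have Aji : A j i = (A i j)^* by rewrite -{1}hA !mxE.
pose t := (A j j + 1) / (`|A i j| ^+ 2 *+ 2).
have n0 : `|A i j| ^+ 2 *+ 2 != 0 by rewrite mulrn_eq0 /= expf_eq0 /= normr_eq0.
have tr : t^* = t.
  apply/CrealP/ger0_real/divr_ge0; first by rewrite addr_ge0 ?psdmx_diag_ge0.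
  by rewrite mulrn_wge0 ?exprn_ge0.
have /= := fA (- (t * A i j) *: delta_mx i 0 + delta_mx j 0).
rewrite adjmxD adjmxZ !trmx_delta !map_delta_mx.
rewrite mulmxDr !mulmxDl -?scalemxAl -?scalemxAr -!rowE -?scalemxAl -!colE !mxE.
rewrite Aii Aji.
set x := (X in 0 <= X); suff -> : x = -1 by rewrite ler0N1.
rewrite /x rmorphN rmorphM /= tr.
transitivity (A j j - t * (`|A i j| ^+ 2 *+ 2)); first by rewrite normCK; ring.
by rewrite /t divfK //; ring.
Qed.
End CompletePositivity.

(** * Normal form of the channels that fix the first basis projector *)

Section TextureChannel.
Variable C : numClosedFieldType.

(** The map whose Choi matrix is the 3 x 3 matrix above, bordered by a zero row and column: [eta] is
    the part of the second population that stays, [c] multiplies the coherence, and [w] feeds the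
    second population into the coherence. *)
Definition texture_map (eta c w : C) (A : 'M[C]_2) : 'M[C]_2 :=
  mx2 (A 0 0 + (1 - eta) * A 1 1) (c * A 0 1 + w * A 1 1)
      (c^* * A 1 0 + w^* * A 1 1) (eta * A 1 1).

Lemma texture_map_is_linear eta c w : linear (texture_map eta c w).
Proof.
by move=> k A B; rewrite /texture_map mx2Z mx2D !mxE; congr mx2; ring.
Qed.

Lemma texture_map_cp (eta c w : C) :
  0 <= eta <= 1 -> `|c| ^+ 2 <= eta ->
  `|w| ^+ 2 <= (1 - eta) * (eta - `|c| ^+ 2) ->
  completely_positive (texture_map eta c w).
Proof.
move=> /andP[eta0 eta1] c_eta w_le.
pose s := sqrtC (1 - eta).
have s2 : s * s = 1 - eta by rewrite -expr2 sqrtCK.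
have s0 : 0 <= s by rewrite sqrtC_ge0 subr_ge0.
have sr : s^* = s by apply/CrealP/ger0_real.
have eta_r : eta^* = eta by apply/CrealP/ger0_real.
(* For s = 0 the quotient is 0 by convention, and the bound on [w] forces w = 0, so p s = w^* holds
   in that case too. *)
pose p := w^* / s; have ps : p * s = w^*.
  rewrite /p; have [s_0|s_n0] := eqVneq s 0; last by rewrite divfK.
  rewrite s_0 mulr0; apply/esym/eqP.
  rewrite conjC_eq0 -normr_eq0 -sqrf_eq0 eq_le exprn_ge0 // andbT.
  by apply: le_trans w_le _; rewrite -s2 s_0 !mul0r.
have p0 : s = 0 -> p = 0 by rewrite /p => ->; rewrite invr0 mulr0.
clearbody p.
have ps' : p^* * s = w by apply: (can_inj conjCK); rewrite rmorphM /= conjCK sr.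
have p_le : `|p| ^+ 2 <= eta - `|c| ^+ 2.
  have [s_0|s_n0] := eqVneq s 0.
    by rewrite p0 // normr0 expr0n /= subr_ge0.
  have s_gt0 : 0 < s by rewrite lt_def s_n0.
  rewrite -(ler_pM2l (mulr_gt0 s_gt0 s_gt0)) s2; apply: le_trans w_le.
  by rewrite -s2 -[w]ps' normrM norm_conjC (ger0_norm s0) exprMn mulrC -expr2.
pose r := sqrtC (eta - `|c| ^+ 2 - `|p| ^+ 2).
have r2 : r * r = eta - c * c^* - p * p^* by rewrite -expr2 sqrtCK !normCK.
have rr : r^* = r by apply/CrealP/ger0_real; rewrite sqrtC_ge0 subr_ge0.
have := cpD (cpD (cp_kraus (mx2 1 0 0 c^*)) (cp_kraus (mx2 0 s 0 p)))
          (cp_kraus (mx2 0 0 0 r)).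
apply: eq_cp => A; rewrite /texture_map [A in LHS]mx2_eta !tr_mx2 !map_mx2 !mx2M !mx2D.
rewrite !conjC0 !conjC1 !conjCK sr rr -ps -ps'.
congr mx2; rewrite ?(mul0r, mulr0, addr0, add0r).
- by rewrite -s2; ring.
- ring.
- ring.
- have -> : eta = r * r + c * c^* + p * p^* by rewrite r2; ring.
  by ring.
Qed.

Lemma lin_mx2 (L : {linear 'M[C]_2 -> 'M[C]_2}) A :
  L A = A 0 0 *: L (delta_mx 0 0) + A 0 1 *: L (delta_mx 0 1) +
        A 1 0 *: L (delta_mx 1 0) + A 1 1 *: L (delta_mx 1 1).
Proof.
rewrite -!linearZ -!linearD; congr (L _).
by rewrite {1}[A]mx2_eta !mx2_delta /= !mx2Z !mx2D; congr mx2; ring.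
Qed.

(** The determinant condition for a nonnegative Hermitian form in two variables. For a > 0 the
    choice p = w, t = a gives a (a b - |w|^2). For a = 0 the choice p = (b + 1) w, t = |w|^2 gives
    -(b + 2) |w|^4, so w = 0. *)
Lemma normC_sqr_le_of_form (a b w : C) : 0 <= a -> 0 <= b ->
  (forall p t : C, 0 <= a * (p * p^*) + b * (t * t^*) - (p^* * w * t + p * w^* * t^*)) ->
  `|w| ^+ 2 <= a * b.
Proof.
move=> a0 b0 form; have ar : a^* = a by apply/CrealP/ger0_real.
move: a0; rewrite le_eqVlt => /predU1P[a_0|a_gt0]; last first.
  rewrite -subr_ge0 -(pmulr_rge0 _ a_gt0); have := form w a.
  by rewrite ar normCK; congr (0 <= _); ring.
have b1_gt0 : 0 < b + 1 by rewrite ltr_wpDl.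
have br : (b + 1)^* = b + 1 by apply/CrealP/ger0_real/ltW.
have := form ((b + 1) * w) (w * w^*); rewrite -a_0 mul0r !rmorphM /= br conjCK.
rewrite [X in 0 <= X](_ : _ = - ((b + 2) * (w * w^*) ^+ 2)); last by ring.
rewrite -normCK oppr_ge0 pmulr_rle0 ?ltr_wpDl // => le0.
have : (`|w| ^+ 2) ^+ 2 == 0 by rewrite eq_le le0 !exprn_ge0.
by rewrite sqrf_eq0 => /eqP ->; rewrite mul0r.
Qed.

Lemma cp_texture_map (L : {linear 'M[C]_2 -> 'M[C]_2}) :
  completely_positive L -> trace_preserving L ->
  L (delta_mx 0 0) = delta_mx 0 0 ->
  exists eta c w : C,
    [/\ 0 <= eta <= 1, `|c| ^+ 2 <= eta,
        `|w| ^+ 2 <= (1 - eta) * (eta - `|c| ^+ 2)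
      & L =1 texture_map eta c w].
Proof.
move=> cp tp L00.
have pG := choi_psd cp.
have G (i k j l : 'I_2) : choi_mx L (mxtens_index (i, k)) (mxtens_index (j, l)) =
    L (delta_mx i j) k l by rewrite mxE !mxtens_indexK.
have tr2 (A : 'M[C]_2) : L A 0 0 + L A 1 1 = A 0 0 + A 1 1.
  by rewrite -[LHS](mxtrace_mx2 _ (L A 0 1) (L A 1 0)) -mx2_eta tp {1}[A]mx2_eta mxtrace_mx2.
(* The diagonal entry of the Choi matrix at (0, 1) is an entry of [L (delta_mx 0 0)] and is 0, so
   its whole row vanishes. *)
have z j l : L (delta_mx 0 j) 1 l = 0.
  by rewrite -G; apply: psdmx_diag_eq0 => //; rewrite G L00 mxE.
(* The image of [delta_mx 0 1] has trace 0, and its other diagonal entry is already 0. *)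
have L01_00 : L (delta_mx 0 1) 0 0 = 0.
  by have := tr2 (delta_mx 0 1); rewrite z !mxE /= !addr0.
have herm i j k l := choi_herm i j k l cp.
pose eta := L (delta_mx 1 1) 1 1; pose c := L (delta_mx 0 1) 0 1.
pose w := L (delta_mx 1 1) 0 1.
have L11_00 : L (delta_mx 1 1) 0 0 = 1 - eta.
  by have := tr2 (delta_mx 1 1); rewrite !mxE /= add0r => /(canRL (addrK _)) ->.
have eta0 : 0 <= eta by rewrite /eta -G psdmx_diag_ge0.
have eta1 : 0 <= 1 - eta by rewrite -L11_00 -G psdmx_diag_ge0.
have L10_00 : L (delta_mx 1 0) 0 0 = 0 by rewrite (herm 0 1 0 0) L01_00 conjC0.
have L10_01 : L (delta_mx 1 0) 0 1 = 0 by rewrite (herm 0 1 1 0) z conjC0.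
have L10_10 : L (delta_mx 1 0) 1 0 = c^* by rewrite (herm 0 1 0 1).
have L10_11 : L (delta_mx 1 0) 1 1 = 0 by rewrite (herm 0 1 1 1) z conjC0.
have L11_10 : L (delta_mx 1 1) 1 0 = w^* by rewrite (herm 1 1 0 1).
(* This is the Schur complement of the Choi matrix with respect to its entry 1: the component -c t
   of the test vector minimizes the form when the others are -p and t. *)
have form p t : 0 <= (1 - eta) * (p * p^*) + (eta - `|c| ^+ 2) * (t * t^*)
                     - (p^* * w * t + p * w^* * t^*).
  have := choi_form (fun i k => mx2 (- c * t) 0 (- p) t i k) cp.
  rewrite !big_ord_recl !big_ord0 !mxE /=.
  have -> : lift ord0 ord0 = 1 :> 'I_2 by apply: val_inj.
  rewrite -![ord0]/(0 : 'I_2) !z L00 L01_00 L10_00 L10_01 L10_10 L10_11 L11_10 L11_00.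
  rewrite -/eta -/c -/w !mxE /= normCK !rmorphM !rmorphN /= conjC0.
  by congr (0 <= _); ring.
exists eta, c, w; split; first by rewrite eta0 -subr_ge0.
- by rewrite -subr_ge0; have := form 0 1; rewrite conjC1 conjC0; congr (0 <= _); ring.
- apply: normC_sqr_le_of_form => //.
  by have := form 0 1; rewrite conjC1 conjC0; congr (0 <= _); ring.
move=> A; rewrite lin_mx2 [LHS]mx2_eta !mxE.
rewrite !z L00 L01_00 L10_00 L10_01 L10_10 L10_11 L11_10 L11_00 -/eta -/c -/w !mxE /=.
by congr mx2; ring.
Qed.
End TextureChannel.

Local Open Scope complex_scope.

(** * Conjugation by the Hadamard matrix *)

Section Bloch.
Variable R : realType.

Definition hadamard_mx : 'M[R[i]]_2 :=
  let s := ((Num.sqrt (2 : R))^-1)%:C in mx2 s s s (- s).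

Definition hadamard (A : 'M[R[i]]_2) := hadamard_mx *m A *m hadamard_mx.

HB.instance Definition _ :=
  GRing.Linear.copy hadamard (mulmxr hadamard_mx \o mulmx hadamard_mx).

Lemma inv_sqrt2_sq : ((Num.sqrt (2 : R))^-1)%:C * ((Num.sqrt (2 : R))^-1)%:C = 2^-1 :> R[i].
Proof.
rewrite -rmorphM -invfM -expr2 sqr_sqrtr ?ler0n // fmorphV /=.
by congr (_^-1); rewrite rmorph_nat.
Qed.

Lemma conj_inv_sqrt2 :
  Num.conj ((Num.sqrt (2 : R))^-1)%:C = ((Num.sqrt (2 : R))^-1)%:C :> R[i].
Proof. exact: conjc_real. Qed.

Lemma two_neq0 : 2 != 0 :> R[i].
Proof. by rewrite pnatr_eq0. Qed.

Lemma addVV2 : 2^-1 + 2^-1 = 1 :> R[i].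
Proof. by rewrite -mulr2n -[_ *+ 2]mulr_natr mulVf ?two_neq0. Qed.

Lemma hadamard_mxK : hadamard_mx *m hadamard_mx = 1%:M.
Proof.
rewrite /hadamard_mx mx2M mx2_1 !(mulrN, mulNr) opprK inv_sqrt2_sq subrr.
by rewrite addVV2.
Qed.

Lemma hadamard_mx_adj : hadamard_mx ^t* = hadamard_mx.
Proof.
by rewrite /hadamard_mx tr_mx2 map_mx2 rmorphN /= conj_inv_sqrt2.
Qed.

Lemma hadamardK : involutive hadamard.
Proof.
move=> A; rewrite /hadamard !mulmxA hadamard_mxK mul1mx.
by rewrite -mulmxA hadamard_mxK mulmx1.
Qed.

Lemma hadamard_mx2 a b c d : hadamard (mx2 a b c d) =
  2^-1 *: mx2 (a + b + c + d) (a - b + c - d) (a + b - c - d) (a - b - c + d).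
Proof.
rewrite /hadamard /hadamard_mx !mx2M mx2Z -inv_sqrt2_sq.
by congr mx2; ring.
Qed.

Lemma mxtrace_hadamard A : \tr (hadamard A) = \tr A.
Proof. by rewrite /hadamard mxtrace_mulC mulmxA hadamard_mxK mul1mx. Qed.

Lemma hadamard_cp : completely_positive hadamard.
Proof.
by apply: eq_cp (cp_kraus hadamard_mx) => A; rewrite hadamard_mx_adj.
Qed.

Lemma hadamard_delta00 : hadamard (delta_mx 0 0) = f1 R.
Proof.
rewrite mx2_delta hadamard_mx2 mx2Z [RHS]mx2_eta !mxE !big_ord1 !mxE /=.
by rewrite !(addr0, add0r, mulr1, subr0) conj_inv_sqrt2 inv_sqrt2_sq.
Qed.

(** * Bloch coordinates in the Hadamard basis *)

Lemma complex_eq (u v : R[i]) :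
  complex.Re u = complex.Re v -> complex.Im u = complex.Im v -> u = v.
Proof. by case: u v => [a b] [c d] /= -> ->. Qed.

(** The Hadamard conjugate of the matrix with Bloch vector (x, y, z): conjugation exchanges
    [sigma_x] and [sigma_z] and negates [sigma_y]. *)
Definition bloch_mx (x y z : R) : 'M[R[i]]_2 :=
  2^-1 *: mx2 (1 + x)%:C (z +i* y) (z -i* y) (1 - x)%:C.

Lemma mx2_bloch x y z : 1%:M + x%:C *: sigma_x R + y%:C *: sigma_y R + z%:C *: sigma_z R
  = mx2 (1 + z)%:C (x -i* y) (x +i* y) (1 - z)%:C.
Proof.
rewrite /sigma_x /sigma_y /sigma_z -![- delta_mx _ _]scaleN1r.
rewrite !mx2_delta mx2_1 /= !(mx2Z, mx2D); congr mx2;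
  rewrite !(mulr0, mulr1, addr0, add0r, mulrN); apply: complex_eq => /=;
  by rewrite ?(mulr1, mulr0, mul0r, mul1r, addr0, oppr0, add0r, subr0).
Qed.

Lemma hadamard_bloch x y z :
  hadamard (2^-1 *: (1%:M + x%:C *: sigma_x R + y%:C *: sigma_y R + z%:C *: sigma_z R))
  = bloch_mx x y z.
Proof.
rewrite mx2_bloch linearZ /= hadamard_mx2 /bloch_mx; congr (_ *: _).
apply: (scalerI two_neq0); rewrite scalerA divff ?two_neq0 // scale1r mx2Z.
congr mx2; apply: complex_eq => /=; ring.
Qed.

Lemma has_blochP rho x y z : has_bloch rho x y z <-> hadamard rho = bloch_mx x y z.
Proof.
by rewrite -hadamard_bloch; split=> [->//|/(can_inj hadamardK)].
Qed.

Lemma density_bloch (rho : 'M[R[i]]_2) : density rho ->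
  exists x y z, has_bloch rho x y z.
Proof.
move=> [[hr _] tr].
have herm i j : Num.conj (rho j i) = rho i j by rewrite -{2}hr !mxE.
have im0 i : complex.Im (rho i i) = 0.
  have /(congr1 (@complex.Im R)) := herm i i; case: (rho i i) => a b /= e.
  lra.
have tr' : complex.Re (rho 0 0) + complex.Re (rho 1 1) = 1.
  move: tr; rewrite {1}[rho]mx2_eta mxtrace_mx2 => /(congr1 (@complex.Re R)).
  by case: (rho 0 0) (rho 1 1) => [a b] [c d] /= ->.
(* These values are read off from the entries in [mx2_bloch]; Hermitian symmetry and trace one give
   the remaining entries. *)
exists (2 * complex.Re (rho 1 0)), (2 * complex.Im (rho 1 0)),
  (2 * complex.Re (rho 0 0) - 1).
rewrite /has_bloch mx2_bloch; apply: (scalerI two_neq0).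
rewrite scalerA divff ?two_neq0 // scale1r {1}[rho]mx2_eta mx2Z -(herm 0 1).
move: (im0 0) (im0 1) tr'.
case: (rho 0 0) (rho 1 0) (rho 1 1) => [a b] [c d] [e f] /= -> -> tr'.
congr mx2; apply: complex_eq => /=; try ring.
lra.
Qed.

Lemma density_pure (v : 'cV[R[i]]_2) : \tr (v *m v ^t*) = 1 -> density (v *m v ^t*).
Proof. by split=> //; apply: psdmx_outer. Qed.

(** The four pure states |+>, (|0> + i|1>)/sqrt 2, |0> and |1> span the space of matrices. *)
Lemma eq_lin_density (f g : {linear 'M[R[i]]_2 -> 'M[R[i]]_2}) :
  (forall rho, density rho -> f rho = g rho) -> f =1 g.
Proof.
move=> fg.
pose ket (a b : R[i]) : 'cV[R[i]]_2 := \col_i (if i == 0 then a else b).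
have outer a b : ket a b *m (ket a b) ^t* =
    mx2 (a * Num.conj a) (a * Num.conj b) (b * Num.conj a) (b * Num.conj b).
  by rewrite [LHS]mx2_eta !mxE !big_ord1 !mxE.
have fgE a b : a * Num.conj a + b * Num.conj b = 1 ->
    f (ket a b *m (ket a b) ^t*) = g (ket a b *m (ket a b) ^t*).
  by move=> n1; apply/fg/density_pure; rewrite outer mxtrace_mx2.
have i_conj : Num.conj 'i%C = - 'i%C :> R[i] by apply: complex_eq; rewrite /= ?oppr0.
have ii : 'i%C * 'i%C = -1 :> R[i] by rewrite -expr2 sqr_i.
pose s := ((Num.sqrt (2 : R))^-1)%:C.
have ss : s * s = 2^-1 := inv_sqrt2_sq.
have s_conj : Num.conj s = s := conj_inv_sqrt2.
have hx : f (2^-1 *: mx2 1 1 1 1) = g (2^-1 *: mx2 1 1 1 1).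
  have := fgE s s; rewrite outer s_conj ss mx2Z !mulr1; apply.
  exact: addVV2.
have hy : f (2^-1 *: mx2 1 (- 'i%C) 'i%C 1) = g (2^-1 *: mx2 1 (- 'i%C) 'i%C 1).
  have := fgE s (s * 'i%C); rewrite outer rmorphM /= s_conj i_conj mx2Z.
  have -> : s * 'i%C * (s * - 'i%C) = 2^-1 * 1.
    by rewrite mulrACA ss mulrN ii opprK.
  have -> : s * (s * - 'i%C) = 2^-1 * - 'i%C by rewrite mulrA ss.
  have -> : s * 'i%C * s = 2^-1 * 'i%C by rewrite mulrAC ss.
  rewrite ss !mulr1; apply.
  exact: addVV2.
have h0 : f (mx2 1 0 0 0) = g (mx2 1 0 0 0).
  have := fgE 1 0; rewrite outer rmorph1 rmorph0 !(mulr0, mul0r, mulr1, addr0); exact.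
have h1 : f (mx2 0 0 0 1) = g (mx2 0 0 0 1).
  have := fgE 0 1; rewrite outer rmorph1 rmorph0 !(mulr0, mul0r, mulr1, add0r); exact.
move=> A; pose b := A 0 1; pose c := A 1 0; pose I : R[i] := 'i%C.
pose e := 2^-1 * (b * (1 + I) + c * (1 - I)).
(* The first two coefficients reproduce the off-diagonal entries [b] and [c]; [e] is what these two
   terms add to each diagonal entry. *)
have -> : A = (b + c) *: (2^-1 *: mx2 1 1 1 1) + ((b - c) * I) *: (2^-1 *: mx2 1 (- I) I 1)
   + (A 0 0 - e) *: mx2 1 0 0 0 + (A 1 1 - e) *: mx2 0 0 0 1.
  rewrite {1}[A]mx2_eta !mx2Z !mx2D -/b -/c.
  have h2 := addVV2.
  have {}ii : I * I = -1 := ii.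
  rewrite /e; clearbody b c I; set h := 2^-1 in h2 *.
  have {}h2 : h = 1 - h by rewrite -[in RHS]h2 addrK.
  clearbody h; congr mx2.
  - ring.
  - transitivity (b * (h + h) + c * (h - h)); first by rewrite {1}h2 subrK subrr mulr1 mulr0 addr0.
    rewrite [in RHS]mulr0 [in RHS]mulr0 !addr0.
    have -> : (b - c) * I * (h * - I) = - (b - c) * h * (I * I) by ring.
    rewrite ii; ring.
  - transitivity (c * (h + h) + b * (h - h)); first by rewrite {1}h2 subrK subrr mulr1 mulr0 addr0.
    rewrite [in RHS]mulr0 [in RHS]mulr0 !addr0.
    have -> : (b - c) * I * (h * I) = (b - c) * h * (I * I) by ring.
    rewrite ii; ring.
  - ring.
rewrite -/I in hy; move: hx hy h0 h1.
move: (2^-1 *: mx2 1 1 1 1) (2^-1 *: mx2 1 (- I) I 1) (mx2 1 0 0 0) (mx2 0 0 0 1).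
move=> X Y E0 E1 hx hy h0 h1; rewrite !(linearD f, linearD g) !(linearZ_LR f, linearZ_LR g).
by rewrite hx hy h0 h1.
Qed.

(** The arccosine of a / r has sine |b / r|, so the sign of b selects this angle or its opposite;
    for r = 0 any angle works. *)
Lemma polar (a b : R) : exists theta,
  a = Num.sqrt (a ^+ 2 + b ^+ 2) * cos theta /\
  b = Num.sqrt (a ^+ 2 + b ^+ 2) * sin theta.
Proof.
have r0 : 0 <= a ^+ 2 + b ^+ 2 by rewrite addr_ge0 ?sqr_ge0.
have := sqrtr_ge0 (a ^+ 2 + b ^+ 2); have := sqr_sqrtr r0.
set r := Num.sqrt _ => r2; rewrite le_eqVlt => /predU1P[r_0|r_gt0].
  exists 0; rewrite -r_0 !mul0r; move: r2; rewrite -r_0 expr0n /= => /esym/eqP.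
  by rewrite paddr_eq0 ?sqr_ge0 // !sqrf_eq0 => /andP[/eqP -> /eqP ->].
have u1 : (a / r) ^+ 2 + (b / r) ^+ 2 = 1.
  by rewrite !expr_div_n -mulrDl r2 divff // gt_eqF // -r2 exprn_gt0.
have u_le : -1 <= a / r <= 1.
  by rewrite -ler_norml -[leRHS](@ger0_norm _ 1) // -ler_sqr ?nnegrE // !real_normK ?num_real // expr1n -u1 lerDl sqr_ge0.
have sinE : sin (acos (a / r)) = `|b / r|.
  by rewrite sin_acos // -u1 addrAC subrr add0r sqrtr_sqr.
have cosE : cos (acos (a / r)) = a / r by rewrite acosK // in_itv.
have [b0|b0] := leP 0 (b / r).
  exists (acos (a / r)); rewrite cosE sinE ger0_norm //.
  by split; rewrite mulrC divfK // gt_eqF.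
exists (- acos (a / r)); rewrite cosN sinN cosE sinE ltr0_norm // opprK.
by split; rewrite mulrC divfK // gt_eqF.
Qed.

Lemma rot_mx_affine (l theta k y z : R) (q : 'cV[R]_2) :
  l *: (rot_mx theta *m vec2 y z) + k *: q =
  vec2 (l * (cos theta * y - sin theta * z) + k * q 0 0)
       (l * (sin theta * y + cos theta * z) + k * q 1 0).
Proof.
have rot0 i : rot_mx theta i 0 = vec2 (cos theta) (sin theta) i 0.
  by rewrite -[RHS](row_mxEl _ (vec2 (- sin theta) (cos theta))); congr (fun_of_matrix _ i _); apply: val_inj.
have rot1 i : rot_mx theta i 1 = vec2 (- sin theta) (cos theta) i 0.
  by rewrite -[RHS](row_mxEr (vec2 (cos theta) (sin theta))); congr (fun_of_matrix _ i _); apply: val_inj.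
have e1 : lift ord0 ord0 = 1 :> 'I_2 by apply: val_inj.
apply/matrixP => i j; rewrite (ord1 j) !mxE !big_ord_recl big_ord0 addr0 e1.
rewrite rot0 rot1 !mxE /=; have [->|i1] := eqVneq i 0; first by rewrite mulNr.
by congr (_ + _ * q _ _); apply: val_inj; case: i i1 => [[|[|]]].
Qed.

Lemma vec2_inj (a b c d : R) : vec2 a b = vec2 c d -> a = c /\ b = d.
Proof. by move=> /matrixP e; split; move: (e 0 0) (e 1 0); rewrite !mxE. Qed.

(** In the coordinate z + i y the components are swapped, so rotating (y, z) by theta is
    multiplication by e^(-i theta). The second population is (1 - x) / 2, whence the factor 1 - x on
    the translation. *)
Lemma texture_map_bloch (eta l theta x y z : R) (q : 'cV[R]_2) :
  texture_map eta%:C ((l * cos theta) -i* (l * sin theta)) (q 1 0 +i* q 0 0)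
    (bloch_mx x y z) =
  bloch_mx (1 - eta + eta * x)
    (l * (cos theta * y - sin theta * z) + (1 - x) * q 0 0)
    (l * (sin theta * y + cos theta * z) + (1 - x) * q 1 0).
Proof.
rewrite /bloch_mx /texture_map mx2Z !mxE /=.
have conjE (a b : R) : Num.conj (a +i* b) = a -i* b by [].
rewrite !conjE ![_ * (2^-1 * _)]mulrCA -!mulrDr -mx2Z; congr (_ *: mx2 _ _ _ _).
- by apply: complex_eq => /=; rewrite ?(mul0r, mulr0, oppr0, addr0, add0r, subr0); ring.
- by apply: complex_eq => /=; rewrite ?(mul0r, mulr0, oppr0, addr0, add0r, subr0); ring.
- by apply: complex_eq => /=; rewrite ?(mul0r, mulr0, oppr0, addr0, add0r, subr0); ring.
- by apply: complex_eq => /=; rewrite ?(mul0r, mulr0, oppr0, addr0, add0r, subr0); ring.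
Qed.

Lemma sqr_enorm2 (q : 'cV[R]_2) : enorm q ^+ 2 = q 0 0 ^+ 2 + q 1 0 ^+ 2.
Proof.
rewrite sqr_sqrtr ?sumr_ge0 // => [|i _]; last exact: sqr_ge0.
rewrite !big_ord_recl big_ord0 addr0; congr (_ + q _ _ ^+ _); exact: val_inj.
Qed.

Lemma sqr_normc (a b : R) : `|a +i* b| ^+ 2 = (a ^+ 2 + b ^+ 2)%:C.
Proof. by rewrite -add_Re2_Im2. Qed.

Lemma le_sqrt_sqr (l eta : R) : 0 <= l -> 0 <= eta ->
  (l <= Num.sqrt eta) = (l ^+ 2 <= eta).
Proof.
by move=> l0 e0; rewrite -[in RHS](sqr_sqrtr e0) ler_sqr ?nnegrE ?sqrtr_ge0.
Qed.
End Bloch.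

(** * The characterization, carried over by Hadamard conjugation *)

Theorem mainTheorem2 (R : realType)
    (Lambda : {linear 'M[R[i]]_2 -> 'M[R[i]]_2}) :
  [/\ completely_positive Lambda,
      trace_preserving Lambda
    & Lambda (f1 R) = f1 R]
  <->
  exists (eta l theta : R) (q : 'cV[R]_2),
    [/\ 0 <= eta <= 1,
        0 <= l <= Num.sqrt eta,
        enorm q ^+ 2 <= (1 - eta) * (eta - l ^+ 2)
      & forall (rho : 'M[R[i]]_2) (x y z : R),
          density rho -> has_bloch rho x y z ->
          exists x' y' z' : R,
            [/\ has_bloch (Lambda rho) x' y' z',
                x' = 1 - eta + eta * x
              & vec2 y' z' =
                  l *: (rot_mx theta *m vec2 y z) + (1 - x) *: q]].
Proof.
split.
  move=> [cp tp fixed].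
  pose L : {linear 'M[R[i]]_2 -> 'M[R[i]]_2} := hadamard (R := R) \o Lambda \o hadamard (R := R).
  have [] := cp_texture_map (L := L).
  - exact: cp_comp (cp_comp (@hadamard_cp R) cp) (@hadamard_cp R).
  - by move=> A /=; rewrite mxtrace_hadamard tp mxtrace_hadamard.
  - by rewrite /= hadamard_delta00 fixed -hadamard_delta00 hadamardK.
  move=> etaC [[c1 c2] [[w1 w2]]].
  case: etaC => eta i_eta [/andP[eta0 eta1] c_le w_le LE].
  (* A nonnegative element of the complex numbers is real, so the inequalities descend to [R]. *)
  have i_eta0 : i_eta = 0 := ger0_Im eta0.
  subst i_eta; move: eta0 eta1 c_le w_le LE; rewrite complexr0 !sqr_normc => eta0 eta1 c_le w_le LE.
  rewrite ler0c in eta0; rewrite lecR in eta1; rewrite lecR in c_le.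
  rewrite -[1 - eta%:C]/(1%:C - _) -!rmorphB -rmorphM lecR in w_le.
  (* The sign is there because c = l e^(-i theta) has imaginary part -l sin theta. *)
  have [theta [c1E c2E]] := polar c1 (- c2); rewrite sqrrN in c1E c2E.
  set l := Num.sqrt _ in c1E c2E.
  have l2 : l ^+ 2 = c1 ^+ 2 + c2 ^+ 2 by rewrite sqr_sqrtr // addr_ge0 ?sqr_ge0.
  have l0 : 0 <= l := sqrtr_ge0 _.
  (* The order is swapped since w = q_z + i q_y while q = (q_y, q_z). *)
  exists eta, l, theta, (vec2 w2 w1); split.
  - by rewrite eta0.
  - by rewrite l0 le_sqrt_sqr // l2.
  - by rewrite sqr_enorm2 !mxE /= l2 addrC.
  move=> rho x y z _ /has_blochP rhoE.
  exists (1 - eta + eta * x),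
    (l * (cos theta * y - sin theta * z) + (1 - x) * w2),
    (l * (sin theta * y + cos theta * z) + (1 - x) * w1).
  split=> //; last by rewrite rot_mx_affine !mxE.
  apply/has_blochP; rewrite -[rho](@hadamardK R) -[LHS]/(L _) LE rhoE.
  have := texture_map_bloch eta l theta x y z (vec2 w2 w1); rewrite !mxE /= => <-.
  by rewrite -c1E -c2E opprK.
move=> [eta [l [theta [q [/andP[eta0 eta1] /andP[l0 l_le] q_le bloch]]]]].
rewrite le_sqrt_sqr // in l_le.
pose c : R[i] := (l * cos theta) -i* (l * sin theta).
pose w : R[i] := q 1 0 +i* q 0 0.
have c2 : `|c| ^+ 2 = (l ^+ 2)%:C.
  by rewrite sqr_normc sqrrN !exprMn -mulrDr cos2Dsin2 mulr1.
pose T := texture_map eta%:C c w.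
have T_lin : linear T := texture_map_is_linear _ _ _.
pose T' : {linear 'M[R[i]]_2 -> 'M[R[i]]_2} :=
  HB.pack T (GRing.isLinear.Build _ _ _ _ T T_lin).
pose L : {linear 'M[R[i]]_2 -> 'M[R[i]]_2} := hadamard (R := R) \o T' \o hadamard (R := R).
(* The Bloch formula describes [Lambda] only on density matrices; linearity extends the equality to
   all matrices. *)
have LE : Lambda =1 L.
  apply: eq_lin_density => rho drho.
  have [x [y [z rho_bloch]]] := density_bloch drho.
  have [x' [y' [z' [/has_blochP LrhoE x'E]]]] := bloch rho x y z drho rho_bloch.
  rewrite rot_mx_affine => /vec2_inj[y'E z'E].
  apply: (can_inj (@hadamardK R)); rewrite LrhoE /= hadamardK.
  move/has_blochP: rho_bloch => ->; rewrite x'E y'E z'E.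
  by rewrite -texture_map_bloch.
split.
- apply: (eq_cp (L := L)); first by move=> A; rewrite LE.
  apply: cp_comp (cp_comp (@hadamard_cp R) _) (@hadamard_cp R).
  apply: texture_map_cp.
  + by rewrite ler0c eta0 lecR.
  + by rewrite c2 lecR.
  + by rewrite c2 sqr_normc -[1 - eta%:C]/(1%:C - _) -!rmorphB -rmorphM lecR addrC -sqr_enorm2.
- move=> A; rewrite LE /= mxtrace_hadamard -[RHS]mxtrace_hadamard /T /texture_map.
  by rewrite mxtrace_mx2 [in RHS](mx2_eta (hadamard A)) mxtrace_mx2; ring.
rewrite LE /= -[in LHS]hadamard_delta00 hadamardK -hadamard_delta00; congr hadamard.
by rewrite /T /texture_map !mxE /= mx2_delta /=; congr mx2; ring.
Qed.
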